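(* Let $(W,S)$ be a finite Coxeter system and $\varphi:W\hookrightarrow\mathrm{Sym}(n)$ ($n\ge 2$) an E-embedding, with borders taken at $\alpha=\pi/4$. Then for every $w\in W$ there is a bijection between $\mathcal{R}_{J_\varphi}(w)$ and $\mathcal{T}_\varphi(w)$; namely, the map sending the equivalence class of a reduced word $s_{i_1}\cdots s_{i_k}$ for $w$ to its tiling $\mathrm{T}_\varphi(s_{i_1}\cdots s_{i_k})$ is well defined and bijective.
   Context: $(W,S)$ is a finite Coxeter system with length $\ell$, $m_{r,s}$ the order of $rs$, reflections $T=\{wsw^{-1}\}$. Right weak order $<_R$: transitive closure of $u<_R us$ ($s\in S$, $\ell(us)=\ell(u)+1$). Bruhat order $<_B$: transitive closure of $u<_B ut$ ($t\in T$, $\ell(ut)=\ell(u)+1$). $\mathrm{Sym}(n)$ = permutations of $\{1,\dots,n\}$ written on the right ($(i)w$ image of $i$; $uv$ = first $u$ then $v$), Coxeter generators $(i,i+1)$, reflections all transpositions. An E-embedding is an injective homomorphism $\varphi:W\to\mathrm{Sym}(n)$ with $u<_R v\Rightarrow\varphi(u)<_B\varphi(v)$. Borders: $\alpha=\pi/4$, $\theta_k=\frac{(k-1)(\pi-2\alpha)}{n-1}+\alpha$, $\beta^k_n=(-\cos\theta_k,\sin\theta_k)$ for $k=1,\dots,n$. For $\sigma\in\mathrm{Sym}(n)$, $p_i(\sigma)=\sum_{j=1}^i\beta_n^{(j)\sigma^{-1}}$ and $\mathrm{B}_n(\sigma)=\bigcup_{i=1}^n[p_{i-1}(\sigma),p_i(\sigma)]\subseteq\mathbb{R}^2$.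 Put $\mathrm{B}_\varphi(w)=\mathrm{B}_n(\varphi(w))$. Tiling: for a reduced expression $s_{i_1}\cdots s_{i_k}$, $\mathrm{T}_\varphi(s_{i_1}\cdots s_{i_k})=\bigcup_{j=0}^k\mathrm{B}_\varphi(s_{i_1}\cdots s_{i_j})\subseteq\mathbb{R}^2$ (the $j=0$ term being $\mathrm{B}_\varphi(\mathrm{id})$). $\mathcal{T}_\varphi(w)$ is the set of all $\mathrm{T}_\varphi(s_{i_1}\cdots s_{i_k})$ over all reduced words $s_{i_1}\cdots s_{i_k}$ for $w$. $J_\varphi$: for distinct $r,s\in S$, $\{r,s\}\in J_\varphi$ iff for every reduced word of the form $x\,\underbrace{srs\cdots}_{m_{s,r}}\,y$ one has $\mathrm{T}_\varphi(x\,\underbrace{srs\cdots}_{m_{s,r}}\,y)=\mathrm{T}_\varphi(x\,\underbrace{rsr\cdots}_{m_{s,r}}\,y)$, where $\underbrace{srs\cdots}_{m}$ is the alternating word of length $m$ starting with $s$. $\mathcal{R}_{J_\varphi}(w)$ is the set of equivalence classes of reduced words for $w$ under the equivalence relation generated by the braid moves $x\,\underbrace{srs\cdots}_{m_{s,r}}\,y\leftrightarrow x\,\underbrace{rsr\cdots}_{m_{s,r}}\,y$ for $\{r,s\}\in J_\varphi$. *)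

(* Defs.v *)
From mathcomp Require Import all_boot all_fingroup.
From Stdlib Require Import Reals Relations.

Set Implicit Arguments.
Unset Strict Implicit.
Unset Printing Implicit Defensive.

Local Open Scope group_scope.

(* Abstract (possibly infinite) groups, used as targets in the universal     *)
(* property defining a Coxeter presentation.                                 *)
Record grp := Grp {
  gcar : Type;
  gmul : gcar -> gcar -> gcar;
  gone : gcar;
  ginv : gcar -> gcar;
  gmulA : forall x y z, gmul x (gmul y z) = gmul (gmul x y) z;
  gmul1 : forall x, gmul gone x = x;
  gmulV : forall x, gmul (ginv x) x = gone
}.

Fixpoint gpow (G : grp) (x : gcar G) (k : nat) : gcar G :=
  match k with O => gone G | S k' => gmul x (gpow x k') end.

(* (W,S) is a Coxeter system: S is a set of involutions generating W, and   *)
(* W has the presentation < S | s^2 = 1, (rs)^{m_{r,s}} = 1 > with          *)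
(* m_{r,s} = #[r*s] the order of rs (universal property w.r.t. all groups). *)
Definition coxeter_system (gT : finGroupType) (W : {group gT}) (S : {set gT}) : Prop :=
  [/\ S \subset W,
      {in S, forall s, #[s] = 2},
      W :=: <<S>>
    & forall (G : grp) (f : gT -> gcar G),
        (forall r s, r \in S -> s \in S -> gpow (gmul (f r) (f s)) #[r * s] = gone G) ->
        exists h : gT -> gcar G,
          (forall x y, x \in W -> y \in W -> h (x * y) = gmul (h x) (h y)) /\
          (forall s, s \in S -> h s = f s)].

Definition wprod (gT : finGroupType) (a : seq gT) : gT := \prod_(s <- a) s.

Definition is_word (gT : finGroupType) (S : {set gT}) (a : seq gT) : Prop :=
  all (fun s => s \in S) a.

Definition coxlen (gT : finGroupType) (S : {set gT}) (w : gT) (k : nat) : Prop :=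
  (exists a, is_word S a /\ wprod a = w /\ size a = k) /\
  (forall a, is_word S a -> wprod a = w -> k <= size a).

Definition reduced (gT : finGroupType) (S : {set gT}) (a : seq gT) : Prop :=
  is_word S a /\ coxlen S (wprod a) (size a).

Definition reduced_for (gT : finGroupType) (S : {set gT}) (w : gT) (a : seq gT) : Prop :=
  reduced S a /\ wprod a = w.

Definition weak_step (gT : finGroupType) (S : {set gT}) (u v : gT) : Prop :=
  exists s, s \in S /\ v = u * s /\ exists k, coxlen S u k /\ coxlen S v k.+1.

Definition weak_lt (gT : finGroupType) (S : {set gT}) : relation gT :=
  clos_trans gT (weak_step S).

(* Sym(n) = {perm 'I_n}: points 0..n-1 stand for 1..n. mathcomp's product   *)
(* satisfies (s * t) x = t (s x), i.e. "first s then t", as in the paper.   *)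
Definition sym_gens (n : nat) : {set {perm 'I_n}} :=
  [set t | [exists i : 'I_n, exists j : 'I_n, (val j == (val i).+1)%N && (t == tperm i j)]].

Definition sym_refls (n : nat) : {set {perm 'I_n}} :=
  [set t | [exists i : 'I_n, exists j : 'I_n, (i != j) && (t == tperm i j)]].

Definition bruhat_step (n : nat) (u v : {perm 'I_n}) : Prop :=
  exists t, t \in sym_refls n /\ v = u * t /\
    exists k, coxlen (sym_gens n) u k /\ coxlen (sym_gens n) v k.+1.

Definition bruhat_lt (n : nat) : relation {perm 'I_n} :=
  clos_trans _ (@bruhat_step n).

Definition E_embedding (gT : finGroupType) (W : {group gT}) (S : {set gT})
    (n : nat) (phi : gT -> {perm 'I_n}) : Prop :=
  [/\ forall x y, x \in W -> y \in W -> phi (x * y) = phi x * phi y,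
      forall x y, x \in W -> y \in W -> phi x = phi y -> x = y
    & forall u v, u \in W -> v \in W -> weak_lt S u v -> @bruhat_lt n (phi u) (phi v)].

Definition pt := (R * R)%type.
Definition rset := pt -> Prop.
Definition rset_eq (X Y : rset) : Prop := forall p, X p <-> Y p.

Definition alpha : R := (PI / 4)%R.

(* theta_k for k = i+1, i : 'I_n *)
Definition theta (n i : nat) : R :=
  (INR i * (PI - 2 * alpha) / INR (n - 1) + alpha)%R.

Definition beta (n i : nat) : pt := ((- cos (theta n i))%R, sin (theta n i)).

Definition border_pt (n : nat) (sigma : {perm 'I_n}) (i : nat) : pt :=
  (\big[Rplus/0%R]_(j < n | (val j < i)%N) fst (beta n (val ((sigma^-1)%g j))),
   \big[Rplus/0%R]_(j < n | (val j < i)%N) snd (beta n (val ((sigma^-1)%g j)))).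

Definition segment (p q : pt) : rset :=
  fun x => exists t : R, (0 <= t <= 1)%R /\
    x = ((fst p + t * (fst q - fst p))%R, (snd p + t * (snd q - snd p))%R).

Definition border (n : nat) (sigma : {perm 'I_n}) : rset :=
  fun x => exists i : nat, (1 <= i <= n)%N /\
    segment (border_pt sigma i.-1) (border_pt sigma i) x.

Definition tiling (gT : finGroupType) (n : nat) (phi : gT -> {perm 'I_n})
    (a : seq gT) : rset :=
  fun x => exists j : nat, (j <= size a)%N /\ border (phi (wprod (take j a))) x.

Definition tilings_of (gT : finGroupType) (S : {set gT}) (n : nat)
    (phi : gT -> {perm 'I_n}) (w : gT) : rset -> Prop :=
  fun X => exists a, reduced_for S w a /\ X = tiling phi a.

Definition alt_word (gT : finGroupType) (s r : gT) (m : nat) : seq gT :=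
  mkseq (fun i => if odd i then r else s) m.

(* {r,s} in J_phi (checked with s first; the condition is symmetric) *)
Definition in_J (gT : finGroupType) (S : {set gT}) (n : nat)
    (phi : gT -> {perm 'I_n}) (r s : gT) : Prop :=
  [/\ r \in S, s \in S, r != s &
    forall x y : seq gT,
      reduced S (x ++ alt_word s r #[s * r] ++ y) ->
      rset_eq (tiling phi (x ++ alt_word s r #[s * r] ++ y))
              (tiling phi (x ++ alt_word r s #[s * r] ++ y))].

Definition braid_step (gT : finGroupType) (S : {set gT}) (n : nat)
    (phi : gT -> {perm 'I_n}) (a b : seq gT) : Prop :=
  exists r s x y, (in_J S phi r s \/ in_J S phi s r) /\
    a = x ++ alt_word s r #[s * r] ++ y /\ b = x ++ alt_word r s #[s * r] ++ y.

Definition J_equiv (gT : finGroupType) (S : {set gT}) (n : nat)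
    (phi : gT -> {perm 'I_n}) : relation (seq gT) :=
  clos_refl_sym_trans _ (braid_step S phi).

(* Main.v *)
Require Import Defs.
From HB Require Import structures.
From mathcomp Require Import all_boot all_fingroup.
From Stdlib Require Import Reals Relations Lra Classical_Prop.
From mathcomp Require Import zify cyclic.

(* Compare points of the plane by [p < q] iff [|q.y - p.y| < q.x - p.x].  For
   [alpha = PI / 4] every border edge is steep, so a border is an antichain,
   while a Bruhat step moves each border vertex by some [beta b - beta a] with
   [a < b], which is flat; hence along a reduced word the borders move
   rightwards, and a vertex stays in place iff the set of labels before it
   does.  Cutting a tiling along its next-to-last border recovers the tiling of
   the shortened word.

   If two reduced words for [w] have the same tiling and the second ends in
   [r], then [r] is moved to the end of the first by J-moves: let the first end
   in [q <> r].  Neither of the borders of [w * q] and [w * r] enters the open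
   strip between the other and the border of [w], which forces [phi q] and
   [phi r] to act on disjoint sets of border edges.  Then [q] and [r] commute
   and lie in [J_phi], and the word without [q] satisfies the same hypotheses,
   so induction applies. *)

Set Implicit Arguments.
Unset Strict Implicit.
Unset Printing Implicit Defensive.

Local Open Scope group_scope.

HB.instance Definition _ := Monoid.isComLaw.Build R 0%R Rplus
  (fun x y z => esym (Rplus_assoc x y z)) Rplus_comm Rplus_0_l.

(** * Steep border steps and flat displacements in the plane *)

Definition cone_lt (p q : pt) : Prop :=
  (snd q - snd p < fst q - fst p)%R /\ (snd p - snd q < fst q - fst p)%R.

Definition up (p q : pt) : Prop :=
  (fst q - fst p <= snd q - snd p)%R /\ (fst p - fst q <= snd q - snd p)%R.

Lemma cone_lt_trans p q r : cone_lt p q -> cone_lt q r -> cone_lt p r.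
Proof. rewrite /cone_lt => -[? ?] [? ?]; split; lra. Qed.

Lemma up_trans p q r : up p q -> up q r -> up p r.
Proof. rewrite /up => -[? ?] [? ?]; split; lra. Qed.

Lemma theta_bounds n i : (2 <= n)%N -> (i < n)%N ->
  (PI / 4 <= theta n i <= 3 * (PI / 4))%R.
Proof.
move=> n2 lin; rewrite /theta /alpha.
have n1 : (0 < INR (n - 1))%R by apply: lt_0_INR; apply/ltP; rewrite subn_gt0.
have hi : (INR i <= INR (n - 1))%R.
  by apply: le_INR; apply/leP; rewrite leq_subRL ?add1n // (leq_trans _ n2).
have hi0 := pos_INR i; have pi0 := PI_RGT_0.
have -> : (INR i * (PI - 2 * (PI / 4)) / INR (n - 1) + PI / 4
   = (INR i / INR (n - 1)) * (PI / 2) + PI / 4)%R by field; lra.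
have qE : ((INR i / INR (n - 1)) * INR (n - 1) = INR i)%R by field; lra.
move: (_ / _)%R qE => q qE.
have q0 : (0 <= q)%R by nra.
have q1 : (q <= 1)%R by nra.
split; nra.
Qed.

Lemma theta_lt n a b : (2 <= n)%N -> (a < b)%N -> (theta n a < theta n b)%R.
Proof.
move=> n2 ab; rewrite /theta /alpha.
have n1 : (0 < INR (n - 1))%R by apply: lt_0_INR; apply/ltP; rewrite subn_gt0.
have hab : (INR a < INR b)%R by apply: lt_INR; apply/ltP.
have pi0 := PI_RGT_0.
have := Rinv_0_lt_compat _ n1; rewrite /Rdiv.
set c := Rinv _ => c0.
have : (INR a * c < INR b * c)%R by nra.
by nra.
Qed.

(* In the coordinates [y - x] and [x + y] the borders are weakly increasing
   staircases; both coordinates of [beta] are multiples of a cosine. *)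
Lemma cos_pi4_shift t :
  (sin t + cos t = cos (t - PI / 4) / cos (PI / 4))%R /\
  (sin t - cos t = - cos (t + PI / 4) / cos (PI / 4))%R.
Proof.
have c0 : (0 < cos (PI / 4))%R by apply: cos_gt_0; have := PI_RGT_0; lra.
have e : sin (PI / 4) = cos (PI / 4) by rewrite sin_cos_PI4.
rewrite cos_minus cos_plus e; split; field; lra.
Qed.

(** By [theta_bounds], [theta - PI / 4] lies in the first quadrant and [theta + PI / 4] in the
    second, which gives the signs of the cosines in [cos_pi4_shift]. *)
Lemma beta_up n i p : (2 <= n)%N -> (i < n)%N ->
  up p ((fst p + fst (beta n i))%R, (snd p + snd (beta n i))%R).
Proof.
move=> n2 lin; rewrite /up /beta /=.
have [t1 t2] := theta_bounds n2 lin; move: (theta n i) t1 t2 => t t1 t2.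
have [e1 e2] := cos_pi4_shift t; have pi0 := PI_RGT_0.
have c0 : (0 < / cos (PI / 4))%R.
  by apply: Rinv_0_lt_compat; apply: cos_gt_0; lra.
have h1 : (0 <= cos (t - PI / 4))%R by apply: cos_ge_0; lra.
have h2 : (cos (t + PI / 4) <= 0)%R by apply: cos_le_0; lra.
rewrite /Rdiv in e1 e2.
have := Rmult_le_pos _ _ h1 (Rlt_le _ _ c0).
have h3 : (0 <= - cos (t + PI / 4))%R by lra.
have := Rmult_le_pos _ _ h3 (Rlt_le _ _ c0).
by split; lra.
Qed.

(** Shifted by [PI / 4] either way, the angles stay between 0 and [PI], where cosine strictly
    decreases. *)
Lemma beta_cone_lt n a b : (2 <= n)%N -> (a < b)%N -> (b < n)%N ->
  cone_lt (beta n a) (beta n b).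
Proof.
move=> n2 ab bn; rewrite /cone_lt /beta /=.
have [a1 a2] := theta_bounds n2 (ltn_trans ab bn).
have [b1 b2] := theta_bounds n2 bn; have := theta_lt n2 ab.
move: (theta n a) (theta n b) a1 a2 b1 b2 => t u t1 t2 u1 u2 tu.
have [e1 e2] := cos_pi4_shift t; have [e3 e4] := cos_pi4_shift u.
have pi0 := PI_RGT_0.
have c0 : (0 < / cos (PI / 4))%R.
  by apply: Rinv_0_lt_compat; apply: cos_gt_0; lra.
have h1 : (cos (u - PI / 4) < cos (t - PI / 4))%R.
  by apply: cos_decreasing_1; lra.
have h2 : (cos (u + PI / 4) < cos (t + PI / 4))%R.
  by apply: cos_decreasing_1; lra.
rewrite /Rdiv in e1 e2 e3 e4.
have := Rmult_lt_compat_r _ _ _ c0 h1; have := Rmult_lt_compat_r _ _ _ c0 h2.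
by split; lra.
Qed.

(** * Borders and their sets of labels *)

Lemma border_ptE n (s : {perm 'I_n}) k :
  border_pt s k = (\big[Rplus/0%R]_(l < n | (s l < k)%N) fst (beta n l),
                   \big[Rplus/0%R]_(l < n | (s l < k)%N) snd (beta n l)).
Proof.
by rewrite /border_pt; congr pair; rewrite (reindex_inj (@perm_inj _ s)) /=;
  apply: eq_big => l //; rewrite permK.
Qed.

(** Coincidence of vertices is recorded through labels, so that permutations can be recovered from
    it in [same_prefix_perm_eq]. *)
Definition same_prefix n (k : nat) (s t : {perm 'I_n}) : bool :=
  [forall l, (s l < k)%N == (t l < k)%N].

Lemma same_prefixP n k (s t : {perm 'I_n}) :
  reflect (forall l, (s l < k)%N = (t l < k)%N) (same_prefix k s t).
Proof. exact: (iffP 'forall_eqP). Qed.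

Lemma same_prefix_sym n k (s t : {perm 'I_n}) :
  same_prefix k s t = same_prefix k t s.
Proof. by apply/same_prefixP/same_prefixP => h l; rewrite h. Qed.

Lemma same_prefix_trans n k (s t u : {perm 'I_n}) :
  same_prefix k s t -> same_prefix k t u -> same_prefix k s u.
Proof.
by move=> /same_prefixP h1 /same_prefixP h2; apply/same_prefixP => l; rewrite h1.
Qed.

Lemma same_prefix_border_pt n k (s t : {perm 'I_n}) :
  same_prefix k s t -> border_pt s k = border_pt t k.
Proof.
by move=> /same_prefixP h; rewrite !border_ptE; congr pair; apply: eq_bigl.
Qed.

Lemma border_ptS n (s : {perm 'I_n}) (k : 'I_n) :
  border_pt s k.+1 =
   ((fst (border_pt s k) + fst (beta n (s^-1 k)))%R,
    (snd (border_pt s k) + snd (beta n (s^-1 k)))%R).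
Proof.
rewrite /border_pt /=; congr pair; rewrite (bigD1 k) //= Rplus_comm;
  by congr Rplus; apply: eq_bigl => j; rewrite ltnS -val_eqE /= ltn_neqAle andbC.
Qed.

Lemma border_pt_up n (s : {perm 'I_n}) i j : (2 <= n)%N -> (i <= j)%N ->
  (j <= n)%N -> up (border_pt s i) (border_pt s j).
Proof.
move=> n2; elim: j => [|j IH] ij jn.
  by move: ij; rewrite leqn0 => /eqP ->; split; lra.
case: (ltngtP i j.+1) ij => // [ij _|-> _]; last by split; lra.
apply: up_trans (IH ij (ltnW jn)) _.
by rewrite (border_ptS s (Ordinal jn)); apply: beta_up.
Qed.

Definition edge_pt n (s : {perm 'I_n}) (k : nat) (t : R) : pt :=
  ((fst (border_pt s k) + t * (fst (border_pt s k.+1) - fst (border_pt s k)))%R,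
   (snd (border_pt s k) + t * (snd (border_pt s k.+1) - snd (border_pt s k)))%R).

Lemma borderP n (s : {perm 'I_n}) z :
  border s z <-> exists k t, (k < n)%N /\ (0 <= t <= 1)%R /\ z = edge_pt s k t.
Proof.
split=> [[[|k] [kn [t [ht ->]]]] //|[k [t [kn [ht ->]]]]].
  by exists k, t.
by exists k.+1; split => //; exists t.
Qed.

Lemma border_edge n (s : {perm 'I_n}) k t :
  (k < n)%N -> (0 <= t <= 1)%R -> border s (edge_pt s k t).
Proof. by move=> kn ht; apply/borderP; exists k, t. Qed.

Lemma edge_pt_up n (s : {perm 'I_n}) k t u : (2 <= n)%N -> (k < n)%N ->
  (t <= u)%R -> up (edge_pt s k t) (edge_pt s k u).
Proof.
move=> n2 kn tu; have [] := border_pt_up s n2 (leqnSn k) kn.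
by rewrite /up /edge_pt /= => h1 h2; split; nra.
Qed.

Lemma edge_pt0 n (s : {perm 'I_n}) k : edge_pt s k 0 = border_pt s k.
Proof. by rewrite /edge_pt [RHS]surjective_pairing; congr pair; ring. Qed.

Lemma edge_pt1 n (s : {perm 'I_n}) k : edge_pt s k 1 = border_pt s k.+1.
Proof. by rewrite /edge_pt [RHS]surjective_pairing; congr pair; ring. Qed.

(** Any two points of one border are related by [up] in one direction, which excludes [cone_lt]. *)
Lemma border_antichain n (s : {perm 'I_n}) p q : (2 <= n)%N ->
  border s p -> border s q -> ~ cone_lt p q.
Proof.
move=> n2.
have upN a b : up a b \/ up b a -> ~ cone_lt a b.
  by rewrite /up /cone_lt => -[[? ?]|[? ?]] [? ?]; lra.
move=> /borderP [i [t [iN [ht ->]]]] /borderP [j [u [jN [hu ->]]]]; apply: upN.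
(* Pass through the end of edge [a] and the start of edge [b]. *)
have far a b x y : (a < b)%N -> (a < n)%N -> (b < n)%N ->
    (0 <= x <= 1)%R -> (0 <= y <= 1)%R -> up (edge_pt s a x) (edge_pt s b y).
  move=> ab an bn hx hy.
  apply: (up_trans (q := edge_pt s a 1)); first by apply: edge_pt_up; tauto.
  apply: (up_trans (q := edge_pt s b 0)); last by apply: edge_pt_up; tauto.
  by rewrite edge_pt1 edge_pt0; apply: border_pt_up => //; apply: ltnW.
case: (ltngtP i j) => [ij|ji|<-]; [by left; apply: far|by right; apply: far|].
by case: (Rle_dec t u) => h; [left|right]; apply: edge_pt_up => //; lra.
Qed.

(** * Domination of borders and its effect on edges *)

(* What remains of the Bruhat order in the plane. *)
Definition dom n (s t : {perm 'I_n}) : Prop :=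
  forall k, same_prefix k s t \/ cone_lt (border_pt s k) (border_pt t k).

Lemma dom_refl n (s : {perm 'I_n}) : dom s s.
Proof. by move=> k; left; apply/same_prefixP. Qed.

Lemma dom_trans n (s t u : {perm 'I_n}) : dom s t -> dom t u -> dom s u.
Proof.
move=> st tu k.
case: (st k) (tu k) => [a|a] [b|b]; [left|right|right|right].
- exact: same_prefix_trans a b.
- by rewrite (same_prefix_border_pt a).
- by rewrite -(same_prefix_border_pt b).
- exact: cone_lt_trans a b.
Qed.

Lemma cone_lt_irrefl p : ~ cone_lt p p.
Proof. by case=> ? ?; lra. Qed.

(** An inner point of an edge averages the displacements of both end vertices with positive weights,
    so one strict displacement suffices. *)
Lemma dom_edge_lt n (s t : {perm 'I_n}) k x : dom s t -> (0 < x < 1)%R ->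
  ~~ (same_prefix k s t && same_prefix k.+1 s t) ->
  cone_lt (edge_pt s k x) (edge_pt t k x).
Proof.
move=> st hx.
have pos a b : (0 <= a)%R -> (0 <= b)%R -> (0 < a + b)%R ->
    (0 < (1 - x) * a + x * b)%R.
  move=> a0 b0 ab; have [e|e] := Req_dec a 0%R; first by nra.
  have h1 : (0 < (1 - x) * a)%R by apply: Rmult_lt_0_compat; lra.
  have h2 : (0 <= x * b)%R by apply: Rmult_le_pos; lra.
  by lra.
have wk p q : p = q \/ cone_lt p q ->
    (0 <= fst q - fst p - (snd q - snd p))%R /\
    (0 <= fst q - fst p - (snd p - snd q))%R.
  by case=> [->|[? ?]]; split; lra.
have le j : border_pt s j = border_pt t j \/ cone_lt (border_pt s j) (border_pt t j).
  by case: (st j) => h; [left; apply: same_prefix_border_pt|right].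
move=> h.
have : cone_lt (border_pt s k) (border_pt t k) \/
       cone_lt (border_pt s k.+1) (border_pt t k.+1).
  case: (st k) => [a|]; last by left.
  by case: (st k.+1) => [b|]; [rewrite a b in h|right].
rewrite /edge_pt; have [u1 u2] := wk _ _ (le k); have [v1 v2] := wk _ _ (le k.+1).
move: (border_pt s k) (border_pt t k) (border_pt s k.+1) (border_pt t k.+1)
  u1 u2 v1 v2 => p q p' q' u1 u2 v1 v2 lt.
rewrite /cone_lt /= in lt *.
have w1 := pos _ _ u1 v1; have w2 := pos _ _ u2 v2.
split.
  have w : (0 < fst q - fst p - (snd q - snd p) +
                (fst q' - fst p' - (snd q' - snd p')))%R by lra.
  by have := w1 w; lra.
have w : (0 < fst q - fst p - (snd p - snd q) +
              (fst q' - fst p' - (snd p' - snd q')))%R by lra.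
by have := w2 w; lra.
Qed.

Lemma dom_edge n (s t : {perm 'I_n}) k x : dom s t -> (0 <= x <= 1)%R ->
  edge_pt s k x = edge_pt t k x \/ cone_lt (edge_pt s k x) (edge_pt t k x).
Proof.
move=> st hx.
have [/andP[a b]|h] := boolP (same_prefix k s t && same_prefix k.+1 s t).
  by left; rewrite /edge_pt (same_prefix_border_pt a) (same_prefix_border_pt b).
have [x0|x0] := Req_dec x 0%R.
  rewrite x0 !edge_pt0; case: (st k) => [a|]; last by right.
  by left; apply: same_prefix_border_pt.
have [x1|x1] := Req_dec x 1%R.
  rewrite x1 !edge_pt1; case: (st k.+1) => [a|]; last by right.
  by left; apply: same_prefix_border_pt.
by right; apply: dom_edge_lt => //; lra.
Qed.

Definition weakly_left n (s : {perm 'I_n}) (z : pt) : Prop :=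
  forall p, border s p -> ~ cone_lt p z.

(** At the same edge and parameter, [t] has a point equal to [z] or right of it; a point of [t] left
    of [z] would contradict [border_antichain]. *)
Lemma dom_weakly_left n (s t : {perm 'I_n}) z : (2 <= n)%N -> dom s t ->
  border s z -> weakly_left t z.
Proof.
move=> n2 st /borderP [k [x [kn [hx ->]]]] p tp pz.
apply: (border_antichain n2 tp (border_edge t kn hx)).
by case: (dom_edge k st hx) => [<- //|]; apply: cone_lt_trans.
Qed.

Lemma border_weakly_left n (s t : {perm 'I_n}) z : dom s t ->
  border t z -> weakly_left s z -> border s z.
Proof.
move=> st /borderP [k [x [kn [hx ->]]]] hl.
case: (dom_edge k st hx) => [<-|lt]; first exact: border_edge.
by case: (hl _ (border_edge s kn hx)).
Qed.

Lemma edge_off_border n (s t : {perm 'I_n}) k x : (2 <= n)%N -> dom s t ->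
  (k < n)%N -> (0 < x < 1)%R ->
  ~~ (same_prefix k s t && same_prefix k.+1 s t) -> ~ border t (edge_pt s k x).
Proof.
move=> n2 st kn hx h ht.
apply: (border_antichain n2 ht _ (dom_edge_lt st hx h)).
by apply: border_edge => //; lra.
Qed.

(** Openness of the cone, used to leave a vertex along an edge. *)
Lemma cone_lt_near p q d : cone_lt p q ->
  exists e, (0 < e < 1)%R /\
    cone_lt p ((fst q + e * fst d)%R, (snd q + e * snd d)%R).
Proof.
case: p q d => [p1 p2] [q1 q2] [d1 d2] [/= h1 h2].
set m := Rmin (q1 - p1 - (q2 - p2)) (q1 - p1 - (p2 - q2)).
have m0 : (0 < m)%R by apply: Rmin_glb_lt; lra.
have m1 := Rmin_l (q1 - p1 - (q2 - p2)) (q1 - p1 - (p2 - q2)).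
have m2 := Rmin_r (q1 - p1 - (q2 - p2)) (q1 - p1 - (p2 - q2)).
rewrite -/m in m1 m2.
(* With [e = m / D], both [e < 1] and [e * (Rabs d1 + Rabs d2) < m], where [m] is the smaller
   slack. *)
set D := (m + Rabs d1 + Rabs d2 + 1)%R.
have a1 := Rabs_pos d1; have a2 := Rabs_pos d2.
have D0 : (0 < D)%R by rewrite /D; lra.
have eD : (m / D * D = m)%R by field; lra.
have b1 := Rle_abs d1; have b1' := Rle_abs (- d1); rewrite Rabs_Ropp in b1'.
have b2 := Rle_abs d2; have b2' := Rle_abs (- d2); rewrite Rabs_Ropp in b2'.
exists (m / D)%R; move: (m / D)%R eD => e eD.
have e0 : (0 < e)%R by nra.
have e1 : (e < 1)%R by rewrite /D in eD; nra.
split; first by [].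
have k : (e * (Rabs d1 + Rabs d2) < m)%R by rewrite /D in eD; nra.
by rewrite /cone_lt /=; split; nra.
Qed.

(** * From Bruhat steps to domination *)

Lemma sum_swap (I : finType) (P Q : pred I) (f : I -> R) a b :
  a != b -> P a -> ~~ P b -> ~~ Q a -> Q b ->
  (forall l, l != a -> l != b -> P l = Q l) ->
  (\big[Rplus/0]_(l | Q l) f l - \big[Rplus/0]_(l | P l) f l = f b - f a)%R.
Proof.
move=> ab Pa Pb Qa Qb PQ.
rewrite (bigD1 b Qb) (bigD1 a Pa) /=.
rewrite (eq_bigl (fun l => P l && (l != a))); first by ring.
move=> l; have [->|la] := eqVneq l a; first by rewrite (negbTE Qa) andbF.
have [->|lb] := eqVneq l b; first by rewrite (negbTE Pb) andbF.
by rewrite (PQ l).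
Qed.

Lemma wprod_cat (gT : finGroupType) (a b : seq gT) :
  wprod (a ++ b) = wprod a * wprod b.
Proof. exact: big_cat. Qed.

Lemma wprod_cons (gT : finGroupType) s (a : seq gT) :
  wprod (s :: a) = s * wprod a.
Proof. exact: big_cons. Qed.

Lemma wprod_nil (gT : finGroupType) : wprod [::] = 1 :> gT.
Proof. exact: big_nil. Qed.

Lemma wprod_rcons (gT : finGroupType) s (a : seq gT) :
  wprod (rcons a s) = wprod a * s.
Proof. by rewrite -cats1 wprod_cat wprod_cons wprod_nil mulg1. Qed.

(* A word carrying [a < b] to an inverted pair swaps the two at some letter;
   deleting that letter multiplies the product by a transposition. *)
Lemma inversion_shorten n (c : seq {perm 'I_n}) (a b : 'I_n) :
  is_word (sym_gens n) c -> (a < b)%N -> (wprod c b < wprod c a)%N ->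
  exists c', [/\ is_word (sym_gens n) c', (size c').+1 = size c
    & wprod c' = wprod c * tperm (wprod c a) (wprod c b)].
Proof.
have swapE (w : {perm 'I_n}) x y : w * tperm (w x) (w y) = tperm x y * w.
  by rewrite -tpermJ -conjgC.
elim: c a b => [|s c IH] a b.
  by rewrite wprod_nil !perm1 => _ ab; rewrite ltnNge ltnW.
rewrite wprod_cons /is_word /= => /andP[]; rewrite inE.
move=> /existsP[i /existsP[j /andP[/eqP ij /eqP ->]]] cw ab; rewrite !permM.
have [/andP[/eqP -> /eqP ->] _|nab] := boolP ((a == i) && (b == j)).
  exists c; split=> //; rewrite tpermL tpermR -mulgA swapE.
  by rewrite mulgA (tpermC j) tperm2 mul1g.
(* A transposition of neighbours reverses only the pair that it swaps, so the inversion arises later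
   in the word. *)
have lt : (tperm i j a < tperm i j b)%N.
  move: nab ij ab; rewrite -!val_eqE /=.
  case: tpermP => [->|->|/eqP + /eqP]; case: tpermP => [->|->|/eqP + /eqP];
    rewrite -?val_eqE /=; lia.
move=> h; have [c' [w' sz e]] := IH _ _ cw lt h.
exists (tperm i j :: c'); split.
- rewrite /= w' andbT inE; apply/existsP; exists i; apply/existsP; exists j.
  by rewrite ij !eqxx.
- by rewrite /= sz.
- by rewrite wprod_cons e mulgA.
Qed.

(** The reflection exchanges the labels [a] and [b] at positions [i < j]. Growth of length forces
    [a < b], and only the vertices with [i < k <= j] move, by [beta b - beta a]. *)
Lemma bruhat_step_dom n (u v : {perm 'I_n}) : (2 <= n)%N ->
  bruhat_step u v -> dom u v.
Proof.
move=> n2 [t [tR [-> [m [[[c [cw [cu cm]]] _] [_ vmin]]]]]].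
have [i [j [ij e]]] : exists i j : 'I_n, (i < j)%N /\ t = tperm i j.
  move: tR; rewrite inE => /existsP[i /existsP[j /andP[]]].
  rewrite -val_eqE neq_ltn => /orP[h /eqP ->|h /eqP ->]; first by exists i, j.
  by exists j, i; rewrite tpermC.
rewrite {t tR}e in vmin *.
set a := u^-1 i; set b := u^-1 j.
have ua : u a = i by rewrite permKV.
have ub : u b = j by rewrite permKV.
have ab : (a < b)%N.
  rewrite ltnNge; apply/negP; rewrite leq_eqVlt => /orP[/eqP h|ba].
    by move: ij; rewrite -ua -ub (val_inj h) ltnn.
  (* Were the labels inverted, a word shorter than [c] would represent the longer permutation. *)
  have h : (wprod c a < wprod c b)%N by rewrite cu ua ub.
  have [c' [w' sz e]] := inversion_shorten cw ba h.
  have := vmin c' w'; rewrite e cu ua ub tpermC => /(_ erefl).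
  by rewrite -cm -sz leqNgt ltnW.
move: (u * tperm i j) (permM u (tperm i j)) => w vE k.
have [/andP[ik kj]|nk] := boolP ((i < k) && (k <= j))%N.
  right; rewrite !border_ptE.
  have [h1 h2] := beta_cone_lt n2 ab (ltn_ord b).
  have sw (f : 'I_n -> R) : Rminus (\big[Rplus/0%R]_(l < n | (w l < k)%N) f l)
      (\big[Rplus/0%R]_(l < n | (u l < k)%N) f l) = Rminus (f b) (f a).
    apply: sum_swap; rewrite ?vE ?ua ?ub ?tpermL ?tpermR -?leqNgt //.
      by rewrite -val_eqE neq_ltn ab.
    move=> l la lb; rewrite vE tpermD //.
      by apply: contra_neq la => h; rewrite /a h permK.
    by apply: contra_neq lb => h; rewrite /b h permK.
  have := sw (fun l => fst (beta n l)); have := sw (fun l => snd (beta n l)).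
  by rewrite /cone_lt; cbn [fst snd]; move=> e1 e2; split; lra.
left; apply/same_prefixP => l; rewrite vE.
by case: tpermP => [->|->|//]; move: nk ij; lia.
Qed.

Lemma bruhat_lt_dom n (u v : {perm 'I_n}) : (2 <= n)%N ->
  bruhat_lt u v -> dom u v.
Proof.
move=> n2; elim=> [x y|x y z _ xy _ yz]; first exact: bruhat_step_dom.
exact: dom_trans xy yz.
Qed.

(** * The strip between two borders and a common successor *)

(** Just beyond vertex [k], the edge of [sr] is still strictly right of [sq], so it must meet [s] in
    an inner point; only an edge shared with [s] can. *)
Lemma strip_no_enter n (s sq sr : {perm 'I_n}) k : (2 <= n)%N -> (k < n)%N ->
  dom sr s ->
  (forall z, border sr z -> weakly_left sq z \/ border s z) ->
  cone_lt (border_pt sq k) (border_pt sr k) ->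
  same_prefix k sr s && same_prefix k.+1 sr s.
Proof.
move=> n2 kn dr HR lt; apply/negPn/negP => h.
set d := (fst (border_pt sr k.+1) - fst (border_pt sr k),
          snd (border_pt sr k.+1) - snd (border_pt sr k))%R.
have [e [he lt']] := cone_lt_near d lt.
have ht : (0 <= e <= 1)%R by lra.
case: (HR _ (border_edge sr kn ht)); last first.
  exact: (edge_off_border n2 dr kn he h).
move=> /(_ (border_pt sq k)); apply=> //.
by rewrite -edge_pt0; apply: border_edge => //; lra.
Qed.

(** From a common vertex, a larger label on [sr] would put the midpoint of its edge strictly right
    of the one on [sq], while that midpoint is not on [s]. *)
Lemma strip_no_split n (s sq sr : {perm 'I_n}) (k : 'I_n) : (2 <= n)%N ->
  dom sr s ->
  (forall z, border sr z -> weakly_left sq z \/ border s z) ->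
  same_prefix k sq sr ->
  ~~ (same_prefix k sr s && same_prefix k.+1 sr s) ->
  (sr^-1 k <= sq^-1 k)%N.
Proof.
move=> n2 dr HR qr h; rewrite leqNgt; apply/negP => lt.
have he : (0 < 1 / 2 < 1)%R by lra.
have ht : (0 <= 1 / 2 <= 1)%R by lra.
case: (HR _ (border_edge sr (ltn_ord k) ht)); last first.
  exact: (edge_off_border n2 dr (ltn_ord k) he h).
move=> /(_ _ (border_edge sq (ltn_ord k) ht)); apply.
have [h1 h2] := beta_cone_lt n2 lt (ltn_ord _).
rewrite /edge_pt !border_ptS (same_prefix_border_pt qr) /cone_lt.
cbn [fst snd]; move: (beta n _) (beta n _) (border_pt sr k) h1 h2.
by move=> [a1 a2] [b1 b2] [c1 c2] /= h1 h2; split; lra.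
Qed.

Lemma same_prefixS n (s t : {perm 'I_n}) (k : 'I_n) :
  same_prefix k s t -> s^-1 k = t^-1 k -> same_prefix k.+1 s t.
Proof.
move=> /same_prefixP h e; apply/same_prefixP => l.
rewrite 2!ltnS leq_eqVlt [(t l <= k)%N]leq_eqVlt h; congr orb.
by rewrite !val_eqE (canF_eq (permK s)) (canF_eq (permK t)) e.
Qed.

Lemma same_prefix0 n (s t : {perm 'I_n}) : same_prefix 0 s t.
Proof. by apply/same_prefixP. Qed.

(* Walking along the borders from the origin, [sq] and [sr] can only leave
   [s] one at a time or together, because neither enters the open strip
   between the other and [s]. *)
Lemma strip_edges n (s sq sr : {perm 'I_n}) : (2 <= n)%N ->
  dom sq s -> dom sr s ->
  (forall z, border sq z -> weakly_left sr z \/ border s z) ->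
  (forall z, border sr z -> weakly_left sq z \/ border s z) ->
  forall k, (k < n)%N ->
    [\/ same_prefix k sq s && same_prefix k.+1 sq s,
        same_prefix k sr s && same_prefix k.+1 sr s |
        same_prefix k sq sr && same_prefix k.+1 sq sr].
Proof.
move=> n2 dq dr HQ HR.
pose inv k := [|| same_prefix k sq s, same_prefix k sr s | same_prefix k sq sr].
have edge k : (k < n)%N -> inv k ->
    [\/ same_prefix k sq s && same_prefix k.+1 sq s,
        same_prefix k sr s && same_prefix k.+1 sr s |
        same_prefix k sq sr && same_prefix k.+1 sq sr].
  move=> kn iv.
  have [eq|nq] := boolP (same_prefix k sq s && same_prefix k.+1 sq s).
    exact: Or31.
  have [er|nr] := boolP (same_prefix k sr s && same_prefix k.+1 sr s).
    exact: Or32.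
  (* Neither edge is shared with [s], so [strip_no_split] applies both ways and the labels are
     equal. *)
  have together : same_prefix k sq sr ->
      same_prefix k sq sr && same_prefix k.+1 sq sr.
    move=> e; rewrite e; apply: (same_prefixS (k := Ordinal kn)) => //.
    apply/val_inj/eqP; rewrite eqn_leq.
    rewrite (strip_no_split (k := Ordinal kn) n2 dr HR) //.
    by rewrite (strip_no_split (k := Ordinal kn) n2 dq HQ) // same_prefix_sym.
  (* If one border meets [s] at vertex [k] and the other is strictly left there, [strip_no_enter]
     makes the first share its edge with [s], which is excluded. *)
  constructor 3; apply: together; case/or3P: iv => // e.
    case: (dr k) => [e'|lt].
      by apply: same_prefix_trans e _; rewrite same_prefix_sym.
    rewrite -(same_prefix_border_pt e) in lt.
    by move: (strip_no_enter n2 kn dq HQ lt) nq => ->.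
  case: (dq k) => [e'|lt].
    by apply: same_prefix_trans e' _; rewrite same_prefix_sym.
  rewrite -(same_prefix_border_pt e) in lt.
  by move: (strip_no_enter n2 kn dr HR lt) nr => ->.
have iv k : (k <= n)%N -> inv k.
  elim: k => [|k IH] kn; first by rewrite /inv same_prefix0.
  rewrite /inv.
  by case: (edge k kn (IH (ltnW kn))) => /andP[_ ->]; rewrite ?orbT.
by move=> k kn; apply: edge => //; apply: iv; apply: ltnW.
Qed.

(** Left multiplication only renames labels, so agreement of prefixes depends on [x] and [y]
    alone. *)
Lemma same_prefixM n k (s x y : {perm 'I_n}) :
  same_prefix k (s * x) (s * y) = same_prefix k x y.
Proof.
apply/same_prefixP/same_prefixP => h l; last by rewrite !permM.
by have := h (s^-1 l); rewrite !permM permKV.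
Qed.

Lemma same_prefixM1 n k (s x : {perm 'I_n}) :
  same_prefix k (s * x) s = same_prefix k x 1.
Proof. by rewrite -{2}[s]mulg1 same_prefixM. Qed.

Lemma same_prefix_perm_eq n (s t : {perm 'I_n}) :
  (forall k, (k < n)%N -> same_prefix k s t) -> s = t.
Proof.
move=> h; apply/permP => l; apply/val_inj/eqP; rewrite eqn_leq.
have all k : same_prefix k s t.
  have [|nk] := ltnP k n; first exact: h.
  by apply/same_prefixP => i; rewrite !(leq_trans (ltn_ord _) nk).
have /same_prefixP/(_ l) := all (s l).+1; rewrite ltnSn ltnS => <-.
by have /same_prefixP/(_ l) := all (t l).+1; rewrite ltnSn ltnS => ->.
Qed.

Definition fixes_edge n (x : {perm 'I_n}) (k : nat) : bool :=
  same_prefix k x 1 && same_prefix k.+1 x 1.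

Lemma fixes_edge_edge_pt n (s x : {perm 'I_n}) k t :
  fixes_edge x k -> edge_pt (s * x) k t = edge_pt s k t.
Proof.
case/andP; rewrite -!(same_prefixM1 _ s) => h1 h2.
by rewrite /edge_pt (same_prefix_border_pt h1) (same_prefix_border_pt h2).
Qed.

Definition disjoint_tiles n (x y : {perm 'I_n}) : Prop :=
  forall k, (k < n)%N -> fixes_edge x k || fixes_edge y k.

Lemma border_disjoint_tiles n (s x y : {perm 'I_n}) z :
  disjoint_tiles x y -> border s z -> border (s * x) z \/ border (s * y) z.
Proof.
move=> dxy /borderP [k [t [kn [ht ->]]]].
by have /orP[h|h] := dxy k kn; [left|right];
  rewrite -(fixes_edge_edge_pt s t h); apply: border_edge.
Qed.

(** By [strip_edges], at every position [x] or [y] is the identity or the two agree; involutions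
    with this property commute. *)
Lemma strip_commute n (s x y : {perm 'I_n}) : (2 <= n)%N ->
  x * x = 1 -> y * y = 1 -> dom (s * x) s -> dom (s * y) s ->
  (forall z, border (s * x) z -> weakly_left (s * y) z \/ border s z) ->
  (forall z, border (s * y) z -> weakly_left (s * x) z \/ border s z) ->
  x * y = y * x.
Proof.
move=> n2 xx yy dx dy HX HY.
have fixE (a b : {perm 'I_n}) (k : 'I_n) :
    same_prefix k a b -> same_prefix k.+1 a b -> a^-1 k = b^-1 k.
  move=> /same_prefixP h1 /same_prefixP h2.
  have := h1 (a^-1 k); have := h2 (a^-1 k); rewrite permKV ltnSn ltnn.
  move=> /esym b2 /esym b1; apply: (canRL (permK b)); apply/val_inj/eqP.
  by rewrite eqn_leq -ltnS b2 leqNgt b1.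
have xV : x^-1 = x by apply: (mulgI x); rewrite mulgV xx.
have yV : y^-1 = y by apply: (mulgI y); rewrite mulgV yy.
have xK p : x (x p) = p by rewrite -permM xx perm1.
have yK p : y (y p) = p by rewrite -permM yy perm1.
have alt (k : 'I_n) : [\/ x k = k, y k = k | x k = y k].
  have := strip_edges n2 dx dy HX HY (ltn_ord k).
  rewrite !same_prefixM1 !same_prefixM.
  case=> /andP[h1 h2]; have := fixE _ _ _ h1 h2; rewrite ?xV ?yV ?invg1 ?perm1.
  - exact: Or31.
  - exact: Or32.
  - exact: Or33.
apply/permP => p; rewrite !permM.
case: (alt p) => [e|e|e].
- rewrite e; case: (alt (y p)) => [-> //|e'|e'].
    by rewrite yK in e'; rewrite -e' e.
  have ye : y p = p by rewrite -[LHS]xK e' yK e.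
  by rewrite ye e.
- rewrite e; case: (alt (x p)) => [e'|-> //|e'].
    by rewrite xK in e'; rewrite -e' e.
  have xe : x p = p by rewrite -[LHS]yK -e' xK e.
  by rewrite xe e.
- by rewrite e yK -e xK.
Qed.

(** Where the prefixes of [x] and [y] differ, one of them, say [y], fixes the prefix. That vertex of
    [s * y] is then on [s], but that of [s * x * y] is on [s * x], strictly further left. *)
Lemma strip_no_ascent n (s x y : {perm 'I_n}) : (2 <= n)%N ->
  x * y = y * x -> x != y -> dom (s * x) s -> dom (s * y) s ->
  (forall z, border (s * x) z -> weakly_left (s * y) z \/ border s z) ->
  (forall z, border (s * y) z -> weakly_left (s * x) z \/ border s z) ->
  dom (s * x) (s * x * y) -> dom (s * y) (s * x * y) -> False.
Proof.
move=> n2 xy nxy dx dy HX HY dvx dvy.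
have E := strip_edges n2 dx dy HX HY.
have noway a b k : dom (s * a) s -> dom (s * b) (s * a * b) ->
    same_prefix k b 1 -> ~~ same_prefix k a b -> False.
  move=> da dv kb ka.
  have ka1 : ~~ same_prefix k a 1.
    apply: contra ka => h; apply: same_prefix_trans h _.
    by rewrite same_prefix_sym.
  have eb : border_pt (s * b) k = border_pt s k.
    by apply: same_prefix_border_pt; rewrite same_prefixM1.
  have ev : border_pt (s * a * b) k = border_pt (s * a) k.
    by apply: same_prefix_border_pt; rewrite same_prefixM1.
  have lt : cone_lt (border_pt (s * a) k) (border_pt s k).
    by case: (da k) => //; rewrite same_prefixM1 (negbTE ka1).
  case: (dv k) => [/same_prefix_border_pt e|lt'].
    by rewrite -ev -e eb in lt; apply: cone_lt_irrefl lt.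
  by rewrite eb ev in lt'; apply: cone_lt_irrefl (cone_lt_trans lt lt').
have sxyE : s * x * y = s * y * x by rewrite -!mulgA xy.
case/eqP: nxy; apply: same_prefix_perm_eq => k kn; apply/negPn/negP => nk.
move: (E k kn); rewrite !same_prefixM1 !same_prefixM (negbTE nk) /=.
case=> // /andP[h _].
  by apply: (noway y x k) => //; [rewrite -sxyE | rewrite same_prefix_sym].
exact: (noway x y k).
Qed.

(** Where [x] and [y] agree on a prefix, [s * x * y] is back at the vertex of [s]. As it is weakly
    left of [s * x], itself weakly left of [s], the vertex has not moved. *)
Lemma strip_disjoint n (s x y : {perm 'I_n}) : (2 <= n)%N ->
  x * x = 1 -> dom (s * x) s -> dom (s * y) s ->
  (forall z, border (s * x) z -> weakly_left (s * y) z \/ border s z) ->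
  (forall z, border (s * y) z -> weakly_left (s * x) z \/ border s z) ->
  dom (s * x * y) (s * x) -> disjoint_tiles x y.
Proof.
move=> n2 xx dx dy HX HY dv k kn; rewrite /fixes_edge.
have inner j : same_prefix j x y -> same_prefix j x 1.
  move=> h; have ev : border_pt (s * x * y) j = border_pt s j.
    apply: same_prefix_border_pt; rewrite -mulgA same_prefixM1 -xx same_prefixM.
    by rewrite same_prefix_sym.
  case: (dx j) => [|lt]; first by rewrite same_prefixM1.
  case: (dv j) => [/same_prefix_border_pt e|lt'].
    by rewrite -e ev in lt; case: (cone_lt_irrefl lt).
  by rewrite ev in lt'; case: (cone_lt_irrefl (cone_lt_trans lt lt')).
move: (strip_edges n2 dx dy HX HY kn); rewrite !same_prefixM1 !same_prefixM.
by case=> [->|->|/andP[/inner -> /inner ->]] //; rewrite orbT.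
Qed.

(** * Tilings of extended words, and alternating words *)

Lemma tiling_rcons n (gT : finGroupType) (phi : gT -> {perm 'I_n}) a q z :
  tiling phi (a ++ [:: q]) z <->
  tiling phi a z \/ border (phi (wprod (a ++ [:: q]))) z.
Proof.
split=> [[j [ja jz]]|[[j [ja jz]]|z2]].
- move: ja; rewrite size_cat addn1 leq_eqVlt => /orP[/eqP e|ja].
    by right; move: jz; rewrite e -addn1 -(size_cat a [:: q]) take_size.
  by left; exists j; split; first by []; rewrite takel_cat in jz.
- exists j; split; first by rewrite size_cat (leq_trans ja) ?leq_addr.
  by rewrite takel_cat.
- by exists (size (a ++ [:: q])); rewrite take_size.
Qed.

Lemma tiling_last n (gT : finGroupType) (phi : gT -> {perm 'I_n}) a z :
  border (phi (wprod a)) z -> tiling phi a z.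
Proof. by exists (size a); rewrite take_size. Qed.

Lemma alt_wordS (gT : finGroupType) (s r : gT) m :
  alt_word s r m.+1 = s :: alt_word r s m.
Proof.
rewrite /alt_word /mkseq /=; congr cons.
by rewrite (iotaDl 1 0) -map_comp; apply: eq_map => i /=; case: (odd i).
Qed.

Lemma wprod_alt_word (gT : finGroupType) (s r : gT) m :
  r * r = 1 -> s * s = 1 ->
  wprod (alt_word s r m) = (s * r) ^+ m * wprod (alt_word r s m).
Proof.
elim: m s r => [|m IH] s r rr ss; first by rewrite mul1g.
rewrite !alt_wordS !wprod_cons (IH r s ss rr) expgSr -!mulgA.
rewrite [in RHS](mulgA r r) rr mul1g.
rewrite !mulgA; congr (_ * _).
(* What remains is [s * (r * s) ^+ m = (s * r) ^+ m * s]. *)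
elim: m {IH} => [|m IH]; first by rewrite mulg1 mul1g.
by rewrite [in RHS]expgS -!mulgA -[_ ^+ m * s]IH expgS !mulgA.
Qed.

Lemma wprod_alt_word_order (gT : finGroupType) (s r : gT) :
  r * r = 1 -> s * s = 1 ->
  wprod (alt_word s r #[s * r]) = wprod (alt_word r s #[s * r]).
Proof. by move=> rr ss; rewrite wprod_alt_word // expg_order mul1g. Qed.

Lemma order_involutions_swap (gT : finGroupType) (s r : gT) :
  r * r = 1 -> s * s = 1 -> #[s * r] = #[r * s].
Proof.
move=> rr ss; rewrite -orderV invMg; congr #[_ * _].
  by apply: (mulgI r); rewrite mulgV rr.
by apply: (mulgI s); rewrite mulgV ss.
Qed.

(** * Reduced words and length *)

Lemma is_word_cat (gT : finGroupType) (S : {set gT}) a b :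
  is_word S (a ++ b) <-> is_word S a /\ is_word S b.
Proof. by rewrite /is_word all_cat; split=> [/andP|[-> ->]]. Qed.

Lemma reduced_prefix (gT : finGroupType) (S : {set gT}) a b :
  reduced S (a ++ b) -> reduced S a.
Proof.
move=> [/is_word_cat[wa wb] [_ h]]; split=> //; split; first by exists a.
move=> d wd e; have := h (d ++ b); rewrite !wprod_cat e !size_cat leq_add2r.
by apply=> //; apply/is_word_cat.
Qed.

Lemma coxlen_uniq (gT : finGroupType) (S : {set gT}) w k l :
  coxlen S w k -> coxlen S w l -> k = l.
Proof.
move=> [[a [wa [ea <-]]] ha] [[b [wb [eb <-]]] hb]; apply/eqP.
by rewrite eqn_leq ha // hb.
Qed.

Lemma reduced_eq_size (gT : finGroupType) (S : {set gT}) a b :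
  reduced S a -> reduced S b -> wprod a = wprod b -> size a = size b.
Proof. by move=> [_ ca] [_ cb] e; rewrite e in ca; apply: coxlen_uniq ca cb. Qed.

Lemma reduced_of_size (gT : finGroupType) (S : {set gT}) a b :
  reduced S a -> is_word S b -> wprod a = wprod b -> size a = size b ->
  reduced S b.
Proof. by move=> [_ c] wb e1 e2; rewrite /reduced -e1 -e2. Qed.

Section Involutions.

Variables (gT : finGroupType) (S : {set gT}).
Hypothesis invS : {in S, forall s, s * s = 1}.

(** Since [r] is an involution, the length changes by at most one; parity rules out no change. *)
Lemma coxlen_step w r m :
  (forall a b, is_word S a -> is_word S b -> wprod a = wprod b ->
     odd (size a) = odd (size b)) ->
  r \in S -> coxlen S w m ->
  (exists2 j, m = j.+1 & coxlen S (w * r) j) \/ coxlen S (w * r) m.+1.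
Proof.
move=> par rS [[a [wa [ea <-]]] ha].
have wr d : is_word S d -> is_word S (d ++ [:: r]).
  by move=> wd; apply/is_word_cat; split=> //; rewrite /is_word /= rS.
have lb d : is_word S d -> wprod d = w * r -> (size a <= (size d).+1)%N.
  move=> wd ed; rewrite -addn1 -(size_cat d [:: r]) ha //; first exact: wr.
  by rewrite cats1 wprod_rcons ed -mulgA invS // mulg1.
have [[c [wc [ec sc]]]|none] :=
    classic (exists c, is_word S c /\ wprod c = w * r /\ (size c < size a)%N).
  left; exists (size c); first by apply/eqP; rewrite eqn_leq sc lb.
  split; first by exists c.
  by move=> d wd ed; rewrite -ltnS (leq_trans sc) ?lb.
have ear : wprod (a ++ [:: r]) = w * r by rewrite cats1 wprod_rcons ea.
right; split.
  by exists (a ++ [:: r]); rewrite size_cat addn1; split; first exact: wr.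
move=> d wd ed; rewrite ltn_neqAle; apply/andP; split.
  apply/eqP => e; have := par d _ wd (wr a wa); rewrite ed ear size_cat addn1 -e.
  by move/(_ erefl) => /=; case: (odd _).
by rewrite leqNgt; apply/negP => h; apply: none; exists d.
Qed.

(** * Invariance under J-moves *)

Lemma braid_step_sym n (phi : gT -> {perm 'I_n}) a b :
  braid_step S phi a b -> braid_step S phi b a.
Proof.
move=> [r [s [x [y [J [-> ->]]]]]].
have [rS sS] : r \in S /\ s \in S by case: J => -[].
exists s, r, x, y; rewrite (order_involutions_swap (invS rS) (invS sS)).
by split=> //; case: J; [right|left].
Qed.

Lemma braid_step_reduced n (phi : gT -> {perm 'I_n}) a b :
  braid_step S phi a b -> reduced S a ->
  [/\ reduced S b, wprod a = wprod b & rset_eq (tiling phi a) (tiling phi b)].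
Proof.
move=> [r [s [x [y [J [-> ->]]]]]] ra.
have [rS sS] : r \in S /\ s \in S by case: J => -[].
have e : wprod (x ++ alt_word s r #[s * r] ++ y) =
    wprod (x ++ alt_word r s #[s * r] ++ y).
  by rewrite !wprod_cat wprod_alt_word_order ?invS.
have rb : reduced S (x ++ alt_word r s #[s * r] ++ y).
  apply: (reduced_of_size ra _ e); last by rewrite !size_cat !size_mkseq.
  have [/is_word_cat[wx /is_word_cat[_ wy]] _] := ra.
  apply/is_word_cat; split=> //; apply/is_word_cat; split=> //.
  by apply/allP => z /mapP[i _ ->]; case: ifP.
split=> //; case: J => [[_ _ _ h]|[_ _ _ h]]; first exact: h ra.
rewrite (order_involutions_swap (invS rS) (invS sS)) in rb *.
by move=> p; case: (h x y rb p).
Qed.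

(** The closure runs over all words, so reducedness has to be transported; assuming it at either end
    lets the induction pass through symmetry. *)
Lemma J_equiv_reduced n (phi : gT -> {perm 'I_n}) a b :
  J_equiv S phi a b -> reduced S a \/ reduced S b ->
  [/\ reduced S a, reduced S b, wprod a = wprod b
    & rset_eq (tiling phi a) (tiling phi b)].
Proof.
elim=> {a b} [a b ab|a|a b _ IH|a b c _ IH1 _ IH2].
- have both : reduced S a -> [/\ reduced S a, reduced S b, wprod a = wprod b
      & rset_eq (tiling phi a) (tiling phi b)].
    by move=> ra; case: (braid_step_reduced ab ra).
  by case=> // rb; apply: both; case: (braid_step_reduced (braid_step_sym ab) rb).
- by case=> ra; split.
- case/or_comm/IH => rb ra e h; split=> //.
  by move=> p; case: (h p).
- case=> [ra|rc].
    have [_ rb e1 h1] := IH1 (or_introl ra).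
    have [_ rc e2 h2] := IH2 (or_introl rb).
    by split=> //; [rewrite e1 | move=> p; rewrite h1].
  have [rb _ e2 h2] := IH2 (or_intror rc).
  have [ra _ e1 h1] := IH1 (or_intror rb).
  by split=> //; [rewrite e1 | move=> p; rewrite h1].
Qed.

Lemma J_equiv_cat n (phi : gT -> {perm 'I_n}) a b d :
  J_equiv S phi a b -> J_equiv S phi (a ++ d) (b ++ d).
Proof.
elim=> {a b} [a b [r [s [x [y [J [-> ->]]]]]]|a|a b _ IH|a b c _ IH1 _ IH2].
- apply: rst_step; exists r, s, x, (y ++ d); split=> //.
  by rewrite -!catA.
- exact: rst_refl.
- exact: rst_sym.
- exact: rst_trans IH1 IH2.
Qed.

End Involutions.

(* The presentation yields the sign character [W -> Z/2] with value [-1] on S. *)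
Lemma coxeter_parity (gT : finGroupType) (W : {group gT}) (S : {set gT}) a b :
  coxeter_system W S -> is_word S a -> is_word S b -> wprod a = wprod b ->
  odd (size a) = odd (size b).
Proof.
move=> [SW _ _ univ] wa wb e.
pose G := @Grp bool addb false (fun x => x) addbA addFb addbb.
have [r s _ _|h [hM hS]] := univ G (fun=> true).
  by elim: #[_] => //= k ->.
have h1 : h 1 = false.
  by have := hM 1 1 (group1 W) (group1 W); rewrite mul1g /=; case: (h 1).
have inW c : is_word S c -> wprod c \in W.
  elim: c => [|s c IH]; first by rewrite wprod_nil.
  by case/andP=> sS /IH cW; rewrite wprod_cons groupM // (subsetP SW).
have hE c : is_word S c -> h (wprod c) = odd (size c).
  elim: c => [|s c IH]; first by rewrite wprod_nil h1.
  case/andP=> sS wc; rewrite wprod_cons hM ?inW ?(subsetP SW) // hS // IH //.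
by rewrite -!hE // e.
Qed.

(** * Tilings under an E-embedding *)

Section EEmbedding.

Variables (gT : finGroupType) (W : {group gT}) (S : {set gT}) (n : nat).
Variable phi : gT -> {perm 'I_n}.
Hypotheses (coxW : coxeter_system W S) (n2 : (2 <= n)%N).
Hypothesis embW : E_embedding W S phi.

Let invS : {in S, forall s, s * s = 1}.
Proof.
case: coxW => _ oS _ _ s sS.
by have := expg_order s; rewrite oS // expgS expg1.
Qed.

Let SW s : s \in S -> s \in W.
Proof. by case: coxW => /subsetP sub _ _ _; apply: sub. Qed.

Let phiM x y : x \in W -> y \in W -> phi (x * y) = phi x * phi y.
Proof. by case: embW => h _ _; apply: h. Qed.

Let phi_inj x y : x \in W -> y \in W -> phi x = phi y -> x = y.
Proof. by case: embW => _ h _; apply: h. Qed.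

Let phi_inv s : s \in S -> phi s * phi s = 1.
Proof.
move=> sS; rewrite -phiM // ?SW // invS //.
(* Only multiplicativity is given; cancelling [phi 1] shows that it is trivial. *)
by apply: (mulgI (phi 1)); rewrite -phiM ?group1 // !mulg1.
Qed.

Lemma wprod_in a : is_word S a -> wprod a \in W.
Proof.
elim: a => [|s c IH]; first by rewrite wprod_nil.
by case/andP=> sS /IH cW; rewrite wprod_cons groupM // ?SW.
Qed.

Lemma coxlen_dom x s k : x \in W -> s \in S -> coxlen S x k ->
  coxlen S (x * s) k.+1 -> dom (phi x) (phi (x * s)).
Proof.
move=> xW sS cx cxs; apply: bruhat_lt_dom => //.
case: embW => _ _ h; apply: h => //; first by rewrite groupM // ?SW.
by apply: t_step; exists s; split=> //; split=> //; exists k.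
Qed.

Lemma reduced_rcons a q : reduced S (a ++ [:: q]) ->
  [/\ reduced S a, q \in S, coxlen S (wprod a) (size a)
    & coxlen S (wprod a * q) (size a).+1].
Proof.
move=> raq; have ra := reduced_prefix raq.
case: raq ra => /is_word_cat[wa wq] c [_ ca].
split=> //; first by move: wq; rewrite /is_word /= andbT.
by move: c; rewrite cats1 wprod_rcons size_rcons.
Qed.

Lemma reduced_prefix_dom a b : reduced S (a ++ b) ->
  dom (phi (wprod a)) (phi (wprod (a ++ b))).
Proof.
elim/last_ind: b => [|b q IH]; first by rewrite cats0 => _; apply: dom_refl.
rewrite -cats1 catA => rab; have [rb qS c1 c2] := reduced_rcons rab.
apply: dom_trans (IH rb) _; rewrite [in X in dom _ X]cats1 wprod_rcons.
by apply: coxlen_dom c2 => //; apply: wprod_in; case: rb.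
Qed.

Lemma tiling_weakly_left a z : reduced S a -> tiling phi a z ->
  weakly_left (phi (wprod a)) z.
Proof.
move=> ra [j [ja jz]]; apply: dom_weakly_left jz => //.
rewrite -{2}(cat_take_drop j a); apply: reduced_prefix_dom.
by rewrite cat_take_drop.
Qed.

(* The last border of [a] cuts [T(a)] out of the tiling of the longer word. *)
Lemma tiling_cut a q z : reduced S (a ++ [:: q]) ->
  tiling phi a z <->
  tiling phi (a ++ [:: q]) z /\ weakly_left (phi (wprod a)) z.
Proof.
move=> raq; have ra := reduced_prefix raq; split=> [az|[]].
  by split; [apply/tiling_rcons; left | apply: tiling_weakly_left].
case/tiling_rcons => // z1 z2; apply: tiling_last.
exact: border_weakly_left (reduced_prefix_dom raq) z1 z2.
Qed.

(** Only the border between the two letters changes. Each of its edges is kept by [q] or by [r], so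
    it also lies on the border before or after the pair. *)
Lemma tiling_swap_sub x q r y z : q \in S -> r \in S -> q * r = r * q ->
  disjoint_tiles (phi q) (phi r) -> is_word S x ->
  tiling phi (x ++ [:: q; r] ++ y) z -> tiling phi (x ++ [:: r; q] ++ y) z.
Proof.
move=> qS rS qr dqr wx [j [jx jz]]; have xW := wprod_in wx.
have [jx'|xj] := leqP j (size x).
  by exists j; split; [rewrite size_cat (leq_trans jx') ?leq_addr
                      | move: jz; rewrite !takel_cat].
have [jx2|jx1] := boolP (j == (size x).+1).
  have xq : border (phi (wprod x * q)) z.
    move: jz; rewrite (eqP jx2) /= -cat_rcons take_size_cat ?size_rcons //.
    by rewrite wprod_rcons.
  rewrite phiM // ?SW // in xq.
  case: (border_disjoint_tiles dqr xq) => xq'.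
    exists (size x); split; first by rewrite size_cat leq_addr.
    by move: xq'; rewrite take_size_cat // -mulgA phi_inv // mulg1.
  exists (size x).+2; split.
    by rewrite !size_cat /= !addnS !ltnS leq_addr.
  move: xq'; rewrite -!phiM ?groupM // ?SW //= -2!cat_rcons.
  by rewrite take_size_cat ?size_rcons // !wprod_rcons -!mulgA qr.
have x2j : ((size x).+2 <= j)%N by rewrite ltn_neqAle eq_sym jx1.
exists j; split; first by move: jx; rewrite !size_cat.
move: jz; rewrite -(subnKC x2j) /= -!cat_rcons !take_cat !size_rcons.
rewrite ltnNge leq_addr /= addKn !wprod_cat !wprod_rcons.
by rewrite -!mulgA (mulgA q) qr !mulgA.
Qed.

Lemma disjoint_tiles_sym (x y : {perm 'I_n}) :
  disjoint_tiles x y -> disjoint_tiles y x.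
Proof. by move=> h k kn; rewrite orbC h. Qed.

(** The product has order two, so the braid move is a swap and [tiling_swap_sub] applies in both
    directions. *)
Lemma disjoint_tiles_in_J q r : q \in S -> r \in S -> q != r ->
  q * r = r * q -> disjoint_tiles (phi q) (phi r) ->
  #[r * q] = 2 /\ in_J S phi q r.
Proof.
move=> qS rS nqr qr dqr.
have o2 : #[r * q] = 2.
  apply: nt_prime_order => //.
    by rewrite expgS expg1 -{1}qr mulgA -(mulgA q) invS // mulg1 invS.
  apply: contra nqr => /eqP e; apply/eqP/(mulgI r).
  by rewrite e invS.
split=> //; split=> // x y; rewrite o2 => -[/is_word_cat[wx _] _] z.
by split; apply: tiling_swap_sub => //; apply: disjoint_tiles_sym.
Qed.

(** The last two hypotheses are what is kept of equality with the tiling of a word ending in [r].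
    They mention no second word and pass to the word without [q]. *)
Lemma reduced_peel a r :
  reduced S a -> r \in S ->
  (exists2 k, size a = k.+1 & coxlen S (wprod a * r) k) ->
  (forall z, border (phi (wprod a * r)) z -> tiling phi a z) ->
  (forall z, tiling phi a z ->
     weakly_left (phi (wprod a * r)) z \/ border (phi (wprod a)) z) ->
  exists c, J_equiv S phi a (c ++ [:: r]).
Proof.
elim/last_ind: a r => [r _ _ [] //|a q IH r]; rewrite -cats1 => raq rS.
have [ra qS ca caq] := reduced_rcons raq.
have aW : wprod a \in W by apply: wprod_in; case: ra.
have sz : size (a ++ [:: q]) = (size a).+1 by rewrite size_cat addn1.
have [-> _ _ _|nqr] := eqVneq q r; first by exists a; apply: rst_refl.
case=> k; rewrite sz => -[<-].
have uE : wprod (a ++ [:: q]) = wprod a * q by rewrite cats1 wprod_rcons.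
rewrite uE; set u := wprod a * q => cur H1 H2.
have uW : u \in W by rewrite groupM // ?SW.
have aE : wprod a = u * q by rewrite -mulgA invS // mulg1.
have urr : u * r * r = u by rewrite -mulgA invS // mulg1.
have duq : dom (phi u * phi q) (phi u).
  by rewrite -phiM // ?SW // -aE; apply: coxlen_dom ca caq.
have dur : dom (phi u * phi r) (phi u).
  by rewrite -phiM // ?SW // -{2}urr; apply: coxlen_dom cur _;
    rewrite ?urr ?groupM // ?SW.
have HQ z : border (phi u * phi q) z ->
    weakly_left (phi u * phi r) z \/ border (phi u) z.
  rewrite -!phiM // ?SW // -aE => h; apply: H2; apply/tiling_rcons; left.
  exact: tiling_last.
have HR z : border (phi u * phi r) z ->
    weakly_left (phi u * phi q) z \/ border (phi u) z.
  rewrite -!phiM // ?SW // -aE => /H1/tiling_rcons; rewrite uE.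
  by case=> h; [left; apply: tiling_weakly_left | right].
have qr : q * r = r * q.
  apply: phi_inj; rewrite ?groupM // ?SW // !phiM // ?SW //.
  exact: strip_commute n2 (phi_inv qS) (phi_inv rS) duq dur HQ HR.
have vE : u * q * r = u * r * q by rewrite -!mulgA qr.
have cuq : coxlen S (u * q) (size a) by rewrite -aE.
have par c d := @coxeter_parity _ _ _ c d coxW.
have vrE : u * q * r * r = u * q by rewrite -mulgA invS // mulg1.
have nphi : phi q != phi r.
  by apply: contra nqr => /eqP/phi_inj ->; rewrite ?SW.
have phiqr : phi q * phi r = phi r * phi q by rewrite -!phiM // ?SW // qr.
(* Otherwise [u * q * r] is longer than both [u * q] and [u * r] and dominates their borders,
   against [strip_no_ascent]. *)
have [j sj cv] : exists2 j, size a = j.+1 & coxlen S (u * q * r) j.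
  have [//|cv] := coxlen_step invS par rS cuq; exfalso.
  apply: strip_no_ascent n2 phiqr nphi duq dur HQ HR _ _;
    rewrite -!phiM // ?groupM // ?SW //.
    by apply: coxlen_dom cuq cv => //; rewrite groupM // ?SW.
  by rewrite vE; apply: coxlen_dom cur _; rewrite -?vE ?groupM // ?SW.
have dv : dom (phi (u * q * r)) (phi (u * q)).
  by rewrite -[in X in dom _ X]vrE; apply: coxlen_dom cv _;
    rewrite ?vrE -?sj ?groupM // ?SW.
have dqr : disjoint_tiles (phi q) (phi r).
  by apply: strip_disjoint n2 (phi_inv qS) duq dur HQ HR _;
    rewrite -!phiM // ?groupM // ?SW.
have [o2 Jqr] := disjoint_tiles_in_J qS rS nqr qr dqr.
have tile z : border (phi (u * q * r)) z ->
    border (phi (u * q)) z \/ border (phi (u * r)) z.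
  move=> /(border_disjoint_tiles dqr).
  rewrite -!phiM // ?groupM // ?SW // vrE vE -(mulgA _ q) invS // mulg1.
  by case; [right|left].
have cvr : coxlen S (wprod a * r) j by rewrite aE.
have [||c' ac'] := IH r ra rS (ex_intro2 _ _ j sj cvr).
(* A point on the border of [u * r] is in the long tiling by [H1]; being weakly left of [u * q], it
   survives the cut. *)
- move=> z; rewrite aE => zv; case: (tile z zv) => h.
    by apply: tiling_last; rewrite aE.
  apply/(tiling_cut z raq); split; first exact: H1.
  by apply: dom_weakly_left zv => //; rewrite aE.
- move=> z /(tiling_cut z raq)[]; rewrite aE => zT zl.
  (* A point on the border of [u] and weakly left of [u * q] is on the latter; one weakly left of
     both [u * q] and [u * r] is weakly left of [u * q * r] by [tile]. *)
  case: (H2 z zT) => zr; last first.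
    by right; apply: border_weakly_left zr zl; rewrite phiM // ?SW.
  by left=> p /tile[]; [apply: zl|apply: zr].
(* Here [a] is equivalent to [c'] followed by [r]; append [q] and swap the last two letters. *)
exists (c' ++ [:: q]).
apply: rst_trans (J_equiv_cat [:: q] ac') _.
apply: rst_step; exists q, r, c', [::]; split; first by left.
by rewrite o2 -!catA.
Qed.

(** After [reduced_peel] both words end in [r]. The words without it have the same product, so
    [tiling_cut] cuts both tilings along the same border and induction applies. *)
Lemma tiling_J_equiv a b : reduced S a -> reduced S b -> wprod a = wprod b ->
  rset_eq (tiling phi a) (tiling phi b) -> J_equiv S phi a b.
Proof.
elim/last_ind: b a => [|b r IH] a ra rb e T.
  by have /size0nil -> := reduced_eq_size ra rb e; apply: rst_refl.
rewrite -cats1 in rb e T *.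
have [rb' rS cb cbr] := reduced_rcons rb.
have er : wprod (b ++ [:: r]) * r = wprod b.
  by rewrite cats1 wprod_rcons -mulgA invS // mulg1.
have [|||c ac] := @reduced_peel a r ra rS.
- exists (size b); last by rewrite e er.
  by rewrite (reduced_eq_size ra rb e) size_cat addn1.
- move=> z; rewrite e er => zb; apply/T/tiling_rcons; left.
  exact: tiling_last.
- move=> z /T/tiling_rcons; rewrite e er.
  by case=> h; [left; apply: tiling_weakly_left | right].
have [_ rc ec Tc] := J_equiv_reduced invS ac (or_introl ra).
apply: rst_trans ac _.
have [rc' _ _ _] := reduced_rcons rc.
have e' : wprod c = wprod b.
  by apply: (mulIg r); rewrite -!wprod_rcons -!cats1 -ec.
apply: J_equiv_cat; apply: IH => // z.
split=> /tiling_cut.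
  move=> /(_ _ rc)[z1 z2]; apply/(tiling_cut z rb).
  by split; [apply/T/Tc | rewrite -e'].
move=> /(_ _ rb)[z1 z2]; apply/(tiling_cut z rc).
by split; [apply/Tc/T | rewrite e'].
Qed.

Lemma J_equiv_tiling a b : reduced S a -> J_equiv S phi a b ->
  rset_eq (tiling phi a) (tiling phi b).
Proof. by move=> ra /(J_equiv_reduced invS)/(_ (or_introl ra))[]. Qed.

End EEmbedding.

(* The class map [a] |-> T_phi(a) from R_{J_phi}(w) to T_phi(w) is well     *)
(* defined, injective and surjective.                                        *)
Theorem theorem1p2 (gT : finGroupType) (W : {group gT}) (S : {set gT})
    (n : nat) (phi : gT -> {perm 'I_n}) :
  coxeter_system W S -> (2 <= n)%N -> E_embedding W S phi ->
  forall w, w \in W ->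
    [/\ (* well defined *)
        forall a b, reduced_for S w a -> reduced_for S w b ->
          J_equiv S phi a b -> rset_eq (tiling phi a) (tiling phi b),
        (* injective *)
        forall a b, reduced_for S w a -> reduced_for S w b ->
          rset_eq (tiling phi a) (tiling phi b) -> J_equiv S phi a b
      & (* surjective onto T_phi(w) *)
        forall X, tilings_of S phi w X ->
          exists a, reduced_for S w a /\ rset_eq (tiling phi a) X].
Proof.
move=> coxW n2 embW w wW; split.
- by move=> a b [ra _] _ ab; apply: (J_equiv_tiling coxW ra ab).
- move=> a b [ra ea] [rb eb]; apply: (tiling_J_equiv coxW n2 embW ra rb).
  by rewrite ea eb.
- by move=> X [a [ra ->]]; exists a.
Qed.
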